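(* In the setting described in the context, assume that the sequence $P\xrightarrow{d^-}\Sigma\xrightarrow{d}V'\to0$ is exact, that $d\,\Pi_\Sigma\Pi_Vv=J_Vv$ for all $v\in V$, and that the norm equivalence $$\|\tau\|_\Sigma^2\eqsim\|\tau\|_{X'}^2+\|d\tau\|_{V'}^2\qquad\forall\,\tau\in\Sigma$$ holds. Then for every $g\in\Sigma'$ and $f\in V'$ the mixed problem of finding $(\sigma,u)\in\Sigma\times V$ such that $$(\sigma,\tau)_{X'}+\langle d\tau,u\rangle=\langle g,\tau\rangle\quad\forall\,\tau\in\Sigma,\qquad \langle d\sigma,v\rangle=\langle f,v\rangle\quad\forall\,v\in V,$$ is uniquely solvable, and $$\|\sigma\|_\Sigma+\|u\|_V\lesssim\|g\|_{\Sigma'}+\|f\|_{V'}.$$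
   Context: $X$, $V$, $\Sigma$ are Hilbert spaces, $P$ and $\widetilde\Sigma$ are Banach spaces, $'$ denotes continuous duals and $\langle\cdot,\cdot\rangle$ duality pairings; $\Sigma\subset X'$. $J_V:V\to V'$ is the isomorphism $\langle J_Vw,v\rangle=(w,v)_V$. The maps $d^-:P\to\Sigma$, $d:\Sigma\to V'$, $\Pi_V:V\to\widetilde\Sigma$, $\Pi_\Sigma:\widetilde\Sigma\to\Sigma$ are continuous and linear (not necessarily isomorphisms). Exactness means $\ker(d)=\operatorname{img}(d^-)$ and $d$ is surjective. $(\cdot,\cdot)_{X'}$ is a symmetric positive semidefinite bilinear form on $X'$ (for instance the inner product of $X'$), and $\|\tau\|_{X'}=(\tau,\tau)_{X'}^{1/2}$. $a\lesssim b$ means $a\le Cb$ with $C$ independent of the functions involved; $a\eqsim b$ means $a\lesssim b$ and $b\lesssim a$. *)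

(* Defs.v *)
From HB Require Import structures.
From mathcomp Require Import all_boot all_order all_algebra ring.
From mathcomp Require Import mathcomp_extra boolp classical_sets functions.
From mathcomp Require Import reals topology normedtype.

Set Implicit Arguments.
Unset Strict Implicit.
Unset Printing Implicit Defensive.

Import Order.TTheory GRing.Theory Num.Theory.
Import numFieldNormedType.Exports.

Local Open Scope classical_set_scope.
Local Open Scope ring_scope.

HB.mixin Record CompleteNormedModule_isHilbert (R : realType) V
    & CompleteNormedModule R V := {
  inner : {dot V for @idfun R} ;
  inner_sqr_norm : forall x : V, inner x x = `|x| ^+ 2 }.

#[short(type="hilbertType")]
HB.structure Definition Hilbert (R : realType) :=
  {V of CompleteNormedModule R V & CompleteNormedModule_isHilbert R V}.

Section hilbert_theory.
Context (R : realType) (V : hilbertType R).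
Implicit Types w v : V.

Lemma innerC w v : inner w v = inner v w.
Proof. by rewrite hermC/= expr0 mul1r. Qed.

Lemma normr_inner_le w v : `|inner w v| <= `|w| * `|v|.
Proof.
have [->|v0] := eqVneq v 0; first by rewrite linear0 !normr0 mulr0.
have N0 : 0 < `|v| ^+ 2 by rewrite exprn_gt0// normr_gt0.
set t := inner w v.
have : 0 <= inner (`|v| ^+ 2 *: w - t *: v) (`|v| ^+ 2 *: w - t *: v).
  by rewrite inner_sqr_norm exprn_ge0.
rewrite linearB/= linearBl linearBl/= !linearZ/= !linearZl_LR/= !inner_sqr_norm.
rewrite (innerC v w) -/t => h.
have : 0 <= `|v| ^+ 2 * (`|w| ^+ 2 * `|v| ^+ 2 - t ^+ 2).
  apply: le_trans h _; rewrite le_eqVlt; apply/orP; left; apply/eqP.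
  by rewrite /GRing.scale/=; ring.
rewrite pmulr_rge0// subr_ge0 -exprMn -[t ^+ 2]real_normK ?num_real//.
by rewrite ler_pXn2r// nnegrE ?mulr_ge0.
Qed.

End hilbert_theory.

Section dual.
Context (R : realType) (V : normedModType R).

Definition is_dual : {pred V -> R} :=
  [pred f : V -> R | `[< linear_for *%R f /\ continuous f >]].

Record dual := Dual { dual_fun :> V -> R ; dualP : dual_fun \in is_dual }.

HB.instance Definition _ := [isSub for dual_fun].
HB.instance Definition _ := [Choice of dual by <:].

Lemma is_dual_submod_closed : submod_closed is_dual.
Proof.
split.
  apply/asboolP; split; last exact: cst_continuous.
  by move=> a x y; rewrite mulr0 addr0.
move=> a f g /asboolP[fl fc] /asboolP[gl gc]; apply/asboolP; split.
  move=> b x y; rewrite !fctE/= fl gl /GRing.scale/=; ring.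
by move=> x; apply: continuousD; [apply: continuousZr; exact: fc|exact: gc].
Qed.

HB.instance Definition _ :=
  GRing.isSubmodClosed.Build R (V -> R) is_dual is_dual_submod_closed.
HB.instance Definition _ := [SubChoice_isSubLmodule of dual by <:].

Implicit Types f g : dual.

Lemma dual_linear f : linear_for *%R f.
Proof. by have /asboolP[] := dualP f. Qed.

Lemma dual_continuous f : continuous f.
Proof. by have /asboolP[] := dualP f. Qed.

HB.instance Definition _ f :=
  GRing.isLinear.Build R V R *%R f (@dual_linear f).

Definition dual_norm f : R := sup [set `|f x| | x in [set x : V | `|x| <= 1]].

Lemma dual_bounded f : exists2 M : R, 0 < M & forall x, `|f x| <= M * `|x|.
Proof.
have fl : linear (f : V -> R^o) by exact: dual_linear.
pose F : {linear V -> R^o} := HB.pack (f : V -> R^o)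
  (GRing.isLinear.Build R V R^o *:%R f fl).
have /linear_boundedP[M [_ Mf]] : bounded_near F (nbhs (0 : V)).
  by apply: (@continuous_linear_bounded _ _ _ 0 F); exact: dual_continuous.
exists (`|M| + 1); first by rewrite ltr_wpDl.
by apply: (Mf (`|M| + 1)); rewrite (le_lt_trans (ler_norm M))// ltrDl.
Qed.

Lemma dual_norm_has_sup f :
  has_sup [set `|f x| | x in [set x : V | `|x| <= 1]].
Proof.
split; first by exists `|f 0|, 0; rewrite //= normr0.
have [M M0 fM] := dual_bounded f; exists M => _ [x /= x1 <-].
by apply: le_trans (fM x) _; rewrite ler_piMr// ltW.
Qed.

Lemma dual_norm_ub f x : `|f x| <= dual_norm f * `|x|.
Proof.
have [->|x0] := eqVneq x 0; first by rewrite linear0 !normr0 mulr0.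
have nx : 0 < `|x| by rewrite normr_gt0.
rewrite -ler_pdivrMr//; apply: ub_le_sup; first by case: (dual_norm_has_sup f).
exists (`|x|^-1 *: x).
  by rewrite /= normrZ normfV normr_id mulVf// gt_eqF.
by rewrite linearZ/= normrM normfV normr_id mulrC.
Qed.

Lemma dual_norm_le f (M : R) :
  (forall x, `|x| <= 1 -> `|f x| <= M) -> dual_norm f <= M.
Proof.
move=> fM; apply: ge_sup; first by case: (dual_norm_has_sup f).
by move=> _ [x x1 <-]; exact: fM.
Qed.

Lemma dual_norm_ge0 f : 0 <= dual_norm f.
Proof.
apply: ub_le_sup; first by case: (dual_norm_has_sup f).
by exists 0; rewrite /= ?normr0// linear0 normr0.
Qed.

Lemma dual_normD f g : dual_norm (f + g) <= dual_norm f + dual_norm g.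
Proof.
apply: dual_norm_le => x x1; rewrite (le_trans (ler_normD _ _))// lerD//.
- by rewrite (le_trans (dual_norm_ub f x))// ler_piMr// dual_norm_ge0.
- by rewrite (le_trans (dual_norm_ub g x))// ler_piMr// dual_norm_ge0.
Qed.

Lemma dual_normZ (a : R) f : dual_norm (a *: f) = `|a| * dual_norm f.
Proof.
have le b h : dual_norm (b *: h) <= `|b| * dual_norm h.
  apply: dual_norm_le => x x1; rewrite normrM ler_wpM2l//.
  by rewrite (le_trans (dual_norm_ub h x))// ler_piMr// dual_norm_ge0.
apply/eqP; rewrite eq_le le/=; have [->|a0] := eqVneq a 0.
  by rewrite normr0 mul0r dual_norm_ge0.
rewrite -ler_pdivlMl ?normr_gt0// -normfV.
by apply: le_trans (le _ _); rewrite scalerA mulVf// scale1r.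
Qed.

Lemma dual_norm0_eq0 f : dual_norm f = 0 -> f = 0.
Proof.
move=> f0; apply/val_inj/funext => x; apply/eqP; rewrite -normr_le0.
by rewrite (le_trans (dual_norm_ub f x))// f0 mul0r.
Qed.

HB.instance Definition _ :=
  Lmodule_isNormed.Build R dual dual_normD dual_normZ dual_norm0_eq0.

End dual.

Section riesz.
Context (R : realType) (V : hilbertType R).

Lemma inner_is_dual (w : V) : inner w \in @is_dual R V.
Proof.
apply/asboolP; split; first by move=> a x y; rewrite linearP.
have il : linear (inner w : V -> R^o) by move=> a x y; rewrite linearP.
pose F : {linear V -> R^o} := HB.pack (inner w : V -> R^o)
  (GRing.isLinear.Build R V R^o *:%R (inner w) il).
apply: (@bounded_linear_continuous _ _ _ F).
apply/linear_boundedP; near=> M => x.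
apply: le_trans (normr_inner_le w x) _; apply: ler_wpM2r => //.
by near: M; apply: nbhs_pinfty_ge; rewrite num_real.
Unshelve. all: by end_near. Qed.

Definition riesz (w : V) : dual V := Dual (inner_is_dual w).

End riesz.

Section mixed_problem.
Context (R : realType).

Definition lesssim (T : Type) (a b : T -> R) :=
  exists2 C : R, 0 < C & forall x, a x <= C * b x.

Definition eqsim (T : Type) (a b : T -> R) := lesssim a b /\ lesssim b a.

Definition seminorm_of (U : lmodType R) (s : {symmetric U}) (x : U) : R :=
  Num.sqrt (s x x).

(* Exactness of P -> S -> W -> 0. *)
Definition exact_seq (P S W : lmodType R) (dm : P -> S) (d : S -> W) :=
  [set tau | d tau = 0] = range dm /\ range d = setT.

(* The linear map iota stands for the inclusion of S in the dual of X. *)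
Definition mixed_problem (X V S : normedModType R) (iota : S -> dual X)
    (s : {symmetric (dual X)}) (d : S -> dual V) (g : dual S) (f : dual V)
    (sigma : S) (u : V) :=
  (forall tau, s (iota sigma) (iota tau) + d tau u = g tau) /\
  (forall v, d sigma v = f v).

End mixed_problem.

(* Main.v *)
Require Import Defs.
From HB Require Import structures.
From mathcomp Require Import all_boot all_order all_algebra.
From mathcomp Require Import mathcomp_extra boolp classical_sets functions.
From mathcomp Require Import reals topology normedtype.
From mathcomp Require Import interval_inference sequences ring lra.

(** Pulling the semi-inner product of X' back to Sigma turns the mixed problem
    into a saddle point problem: a symmetric positive semidefinite form b on
    Sigma, bounded by one inequality of the norm equivalence, and the constraint
    operator d. The other inequality says that b is coercive on the kernel of d, and
    the composite E of the two operators Pi is a bounded right inverse of d up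
    to the Riesz map, that is d (E v) = riesz v. These are Brezzi's conditions,
    E playing the part of the inf-sup condition.

    Stability ([saddle_point_bound]). Testing the first equation with E u
    recovers the squared norm of u from the term d (E u) u, so the norm of u
    is controlled by those of g and sigma. Testing it with sigma, where
    d sigma u = f u, bounds b sigma sigma + |d sigma|^2, hence |sigma|^2, by
    (|g| + |f|) |sigma| + (|g| + |f|)^2 up to a constant; a quadratic
    inequality of this kind forces |sigma| to be at most a multiple of
    |g| + |f|. Uniqueness is stability applied to the difference of two
    solutions.

    Existence ([saddle_point_exists]). Write f = riesz w. Then E w meets the
    constraint, and it is corrected by an element of the kernel of d so that
    the first equation holds for all tau in the kernel. The residual
    functional tau |-> g tau - b sigma tau then vanishes on the kernel, so it
    factors through d, and u is the Riesz representative of its composition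
    with E.

    The correction and the Riesz representatives both come from
    [coercive_form_representation], which minimizes a quadratic energy on a
    closed subspace. *)

Set Implicit Arguments.
Unset Strict Implicit.
Unset Printing Implicit Defensive.

Import Order.TTheory GRing.Theory Num.Theory.
Import numFieldNormedType.Exports.

Local Open Scope classical_set_scope.
Local Open Scope ring_scope.

(** * Bounded linear maps and functionals *)

Section bounded_maps.
Context (R : realType).

Lemma continuous_linear_bound (U W : normedModType R) (f : {linear U -> W}) :
  continuous f -> exists2 M, 0 < M & forall x, `|f x| <= M * `|x|.
Proof.
move=> fc; have /linear_boundedP[M [_ Mf]] : bounded_near f (nbhs (0 : U)).
  by apply: continuous_linear_bounded; exact: fc.
exists (`|M| + 1); first by rewrite ltr_wpDl.
by apply: Mf; rewrite (le_lt_trans (ler_norm M))// ltrDl.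
Qed.

Lemma bounded_is_dual (U : normedModType R) (f : U -> R) (M : R) :
  linear_for *%R f -> (forall x, `|f x| <= M * `|x|) -> f \in @is_dual R U.
Proof.
move=> fl fM; apply/asboolP; split => //.
pose F : {linear U -> R^o} := HB.pack (f : U -> R^o)
  (GRing.isLinear.Build R U R^o *:%R f fl).
apply: (@bounded_linear_continuous _ _ _ F); apply/linear_boundedP.
near=> r => x; apply: le_trans (fM x) _; apply: ler_wpM2r => //.
by near: r; apply: nbhs_pinfty_ge; rewrite num_real.
Unshelve. all: by end_near. Qed.

End bounded_maps.

(** * Positive semidefinite symmetric forms *)

Section forms.
Context (R : realType).

Lemma symC (U : lmodType R) (a : {symmetric U}) x y : a x y = a y x.
Proof. by rewrite hermC/= expr0 mul1r. Qed.

(** Expanding a z z >= 0 at z = |y| x +- |x| y bounds 2 |x| |y| |a x y| by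
    |y|^2 (a x x) + |x|^2 (a y y). The weights are chosen so that both terms
    of this sum are at most A |x|^2 |y|^2. *)
Lemma psd_form_bound (U : normedModType R) (a : {symmetric U}) (A : R) :
  (forall x, 0 <= a x x) -> (forall x, a x x <= A * `|x| ^+ 2) ->
  forall x y, `|a x y| <= A * `|x| * `|y|.
Proof.
move=> a0 aA x y.
have [->|x0] := eqVneq x 0; first by rewrite linear0l !normr0 mulr0 mul0r.
have [->|y0] := eqVneq y 0; first by rewrite linear0 !normr0 mulr0.
have nx : 0 < `|x| by rewrite normr_gt0.
have ny : 0 < `|y| by rewrite normr_gt0.
have E (t : R) : 0 <= `|y| ^+ 2 * a x x + 2 * t * `|y| * `|x| * a x y
    + t ^+ 2 * `|x| ^+ 2 * a y y.
  have := a0 (`|y| *: x + (t * `|x|) *: y).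
  rewrite linearD/= !linearDl/= !linearZ/= !linearZl_LR/= (symC a y x).
  by rewrite /GRing.scale/=; congr (0 <= _); ring.
have := E 1; have := E (-1); have := aA x; have := aA y.
set s := a x y; set p := a x x; set q := a y y => qA pA h1 h2.
have nxy : 0 < `|x| * `|y| by rewrite mulr_gt0.
rewrite ler_norml; apply/andP; split; rewrite -(ler_pM2l nxy).
- by nra.
- by nra.
Qed.

Definition pullback_form (S U : lmodType R) (a : {symmetric U})
  (i : {linear S -> U}) (x y : S) : R := a (i x) (i y).

Section pullback.
Context (S U : lmodType R) (a : {symmetric U}) (i : {linear S -> U}).

Lemma pullback_form_bilinear :
  bilinear_for *%R *%R (pullback_form a i).
Proof.
split=> z t x y; rewrite /pullback_form linearP; first by rewrite linearPl.
by rewrite linearP.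
Qed.

HB.instance Definition _ :=
  bilinear_isBilinear.Build R S S R *%R *%R (pullback_form a i)
    pullback_form_bilinear.

Lemma pullback_form_sym x y :
  pullback_form a i x y = (-1) ^+ false * idfun (pullback_form a i y x).
Proof. by rewrite /pullback_form symC expr0 mul1r. Qed.

HB.instance Definition _ :=
  isHermitianSesquilinear.Build R S false idfun (pullback_form a i)
    pullback_form_sym.

End pullback.
End forms.

(** * Riesz representation on a closed subspace *)

Section representation.
Context (R : realType) (H : completeNormedModType R).

(** The representative minimizes the energy J x = a x x - 2 l x on K, which is
    bounded below by coercivity. By the parallelogram identity, two nearly
    minimal points have a midpoint of energy at least m = inf J only if they
    are close for a, hence in norm; so minimizing sequences are Cauchy. Their
    limit satisfies the Euler equation because a nearly minimal point nearly
    does: a residual r = a x y - l y would lower the energy by about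
    r^2 / (a y y + 1). *)
Lemma coercive_form_representation (a : {symmetric H}) (K : set H) (A C : R)
    (l : dual H) :
  (forall x, 0 <= a x x) -> (forall x, a x x <= A * `|x| ^+ 2) ->
  closed K -> K 0 -> (forall t x y, K x -> K y -> K (t *: x + y)) ->
  0 < C -> (forall x, K x -> `|x| ^+ 2 <= C * a x x) ->
  exists2 x, K x & forall y, K y -> a x y = l y.
Proof.
move=> a0 aA Kc K0 KP C0 aC.
pose J x := a x x - 2 * l x.
have JE x t y : J (x + t *: y) = J x + 2 * t * (a x y - l y) + t ^+ 2 * a y y.
  rewrite /J linearD/= !linearDl/= !linearZ/= !linearZl_LR/= linearD/= linearZ/=.
  by rewrite (symC a y x) /GRing.scale/=; ring.
(* Complete the square in |x| - C |l|, after scaling by C. *)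
have lbJ : has_inf (J @` K).
  split; first by exists (J 0), 0.
  exists (- (C * `|l| ^+ 2)) => _ [x Kx <-].
  have ax := aC _ Kx.
  have lx : l x <= `|l| * `|x| := le_trans (ler_norm _) (dual_norm_ub l x).
  rewrite -(ler_pM2l C0) /J.
  have : 0 <= (`|x| - C * `|l|) ^+ 2 by rewrite sqr_ge0.
  have : C * l x <= C * (`|l| * `|x|) by rewrite ler_pM2l.
  by nra.
pose m := inf (J @` K).
have mJ x : K x -> m <= J x.
  by move=> Kx; apply: ge_inf; [case: lbJ|exists x].
have /choice[x_ /all_and2[Kx xJ]] n :
    exists x, K x /\ J x < m + harmonic n.
  have h0 : 0 < harmonic n :> R by rewrite /= invr_gt0.
  by have [_ [x Kx <-] xm] := inf_adherent h0 lbJ; exists x.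
have KD x y : K x -> K y -> K (x + y).
  by move=> ? ?; rewrite -[x]scale1r; exact: KP.
have KZ t x : K x -> K (t *: x) by move=> ?; rewrite -[_ *: _]addr0; exact: KP.
have xB n p : `|x_ n - x_ p| ^+ 2 <= 2 * C * (harmonic n + harmonic p).
  have Kd : K (x_ n - x_ p) by rewrite -scaleN1r; apply: KD; last exact: KZ.
  apply: le_trans (aC _ Kd) _; rewrite -mulrA [_ * (C * _)]mulrCA ler_pM2l//.
  (* The point below is the midpoint of x_ n and x_ p. *)
  have := mJ (x_ n + (-1/2) *: (x_ n - x_ p)) (KD _ _ (Kx n) (KZ _ _ Kd)).
  have := xJ n; have := xJ p.
  have -> : x_ p = x_ n + (-1) *: (x_ n - x_ p).
    by rewrite scaleN1r opprB addrC subrK.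
  rewrite !JE opprD addNKr.
  rewrite scaleN1r opprK => h1 h2 h3.
  by move: h1 h2 h3; lra.
have /cauchy_cvg/cvg_ex[/= x xx] : cauchy (x_ @ \oo).
  apply/cauchy_ballP => e e0.
  have d0 : 0 < e ^+ 2 / (4 * C) by rewrite divr_gt0// ?exprn_gt0// mulr_gt0.
  exists ([set x | exists2 n, harmonic n < e ^+ 2 / (4 * C) & x = x_ n],
          [set x | exists2 n, harmonic n < e ^+ 2 / (4 * C) & x = x_ n]) => /=.
    have P := near_infty_natSinv_lt (PosNum d0).
    by split; apply: (filterS _ P) => n hn; exists n.
  move=> [_ _] /= [[n hn ->] [p hp ->]].
  rewrite -ball_normE/= -(@ltr_pXn2r _ 2)// ?nnegrE// ?ltW//.
  apply: le_lt_trans (xB n p) _.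
  have -> : e ^+ 2 = 2 * C * (e ^+ 2 / (4 * C) + e ^+ 2 / (4 * C)).
    by field; rewrite gt_eqF.
  by rewrite ltr_pM2l ?mulr_gt0// ltrD.
exists x; first by apply: (closed_cvg _ Kc _ _ xx); exact: nearW.
move=> y Ky.
have ay : (fun z => a z y) \in @is_dual R H.
  apply: (@bounded_is_dual _ _ _ (A * `|y|)) => [t u v|u].
    by rewrite linearPl.
  by rewrite mulrAC; exact: psd_form_bound.
have rx : (fun n => (a (x_ n) y - l y) ^+ 2) @ \oo --> (a x y - l y) ^+ 2.
  suff h : (fun n => a (x_ n) y - l y) @ \oo --> a x y - l y.
    by rewrite expr2; under eq_fun do rewrite expr2; exact: cvgM.
  apply: cvgB; last exact: cvg_cst.
  exact: (cvg_comp _ _ xx (@dual_continuous _ _ (Dual ay) x)).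
(* The residual is shown to have square at most (a y y + 1) * harmonic n; the
   + 1 keeps the denominator positive when a y y = 0. *)
have q0 := a0 y; have q1 : 0 < a y y + 1 by rewrite ltr_wpDl.
have /(ler_cvg_to rx) r0 : (fun n => (a y y + 1) * harmonic n) @ \oo --> (0 : R).
  by rewrite -(mulr0 (a y y + 1)); apply: cvgMr; exact: cvg_harmonic.
apply/eqP; rewrite -subr_eq0 -sqrf_eq0 eq_le sqr_ge0 andbT; apply: r0.
apply: nearW => n; set r := a (x_ n) y - l y.
(* The step - r / (a y y + 1) along y minimizes the energy up to the + 1. *)
have := mJ _ (KD _ _ (Kx n) (KZ (- r / (a y y + 1)) _ Ky)).
rewrite JE -/r -subr_ge0 => h; have := xJ n; rewrite -subr_gt0 => h'.
rewrite -ler_pdivrMl//.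
have {h h'} : 0 <= harmonic n + 2 * (- r / (a y y + 1)) * r
    + (- r / (a y y + 1)) ^+ 2 * a y y by move: h h'; lra.
set s := r / (a y y + 1); have -> : - r / (a y y + 1) = - s by rewrite mulNr.
have -> : r = s * (a y y + 1) by rewrite divfK// gt_eqF.
have -> : (a y y + 1)^-1 * (s * (a y y + 1)) ^+ 2 = s ^+ 2 * (a y y + 1).
  by field; rewrite gt_eqF.
have := sqr_ge0 s; move: (harmonic n) => h s0.
by nra.
Qed.

End representation.

(** * Saddle point problems with a right inverse of the constraint *)

Section saddle_point.
Context (R : realType).

Lemma le_of_sqr_le (D N x : R) : 0 <= D -> 0 <= N ->
  x ^+ 2 <= D * N * x + D * N ^+ 2 -> x <= (D + 1) * N.
Proof.
move=> D0 N0 h; rewrite leNgt; apply/negP => lt.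
have D1 : 0 < D + 1 by rewrite ltr_wpDl.
have x0 : 0 < x by apply: le_lt_trans lt; rewrite mulr_ge0// ltW.
have Nx : N < x by apply: le_lt_trans lt; rewrite mulrDl mul1r lerDr mulr_ge0.
have : D * (N * N) <= D * (N * x) by rewrite !ler_wpM2l// ltW.
have : D * N * x < (x - N) * x by rewrite ltr_pM2r//; lra.
by nra.
Qed.

Lemma riesz_surj (V : hilbertType R) (f : dual V) : exists w, riesz w = f.
Proof.
pose a : {symmetric V} := @inner R V.
have aE x : a x x = `|x| ^+ 2 := inner_sqr_norm x.
have [|||||||w _ wf] := @coercive_form_representation R V a setT 1 1 f => //.
- by move=> x; rewrite aE exprn_ge0.
- by move=> x; rewrite aE mul1r.
- by move=> x _; rewrite aE mul1r.
by exists w; apply/val_inj/funext => v; exact: wf.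
Qed.

Context (V : hilbertType R) (S : completeNormedModType R).
Context (b : {symmetric S}) (d : {linear S -> dual V}) (E : {linear V -> S}).
Context (A C M : R).
Hypothesis b_ge0 : forall x, 0 <= b x x.
Hypothesis A_gt0 : 0 < A.
Hypothesis b_le : forall x, b x x <= A * `|x| ^+ 2.
Hypothesis C_gt0 : 0 < C.
Hypothesis b_coercive : forall x, `|x| ^+ 2 <= C * (b x x + `|d x| ^+ 2).
Hypothesis M_gt0 : 0 < M.
Hypothesis E_le : forall v, `|E v| <= M * `|v|.
Hypothesis dE : forall v, d (E v) = riesz v.

Let b_bound x y : `|b x y| <= A * `|x| * `|y|.
Proof. exact: psd_form_bound. Qed.

(** Testing with E u works because d (E u) u = inner u u is the squared norm
    of u. *)
Lemma multiplier_bound (g : dual S) (sigma : S) (u : V) :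
  (forall tau, b sigma tau + d tau u = g tau) ->
  `|u| <= M * (`|g| + A * `|sigma|).
Proof.
move=> eq1; have B0 : 0 <= `|g| + A * `|sigma|.
  by rewrite addr_ge0// mulr_ge0// ltW.
have [->|u0] := eqVneq u 0; first by rewrite normr0 mulr_ge0// ltW.
have nu : 0 < `|u| by rewrite normr_gt0.
have := eq1 (E u); rewrite dE /= inner_sqr_norm => e.
have gE : g (E u) <= `|g| * `|E u| :=
  le_trans (ler_norm _) (dual_norm_ub g (E u)).
have := b_bound sigma (E u); rewrite ler_norml => /andP[bE _].
rewrite -(ler_pM2r nu) [leRHS]mulrAC [leRHS]mulrC.
apply: (@le_trans _ _ ((`|g| + A * `|sigma|) * `|E u|)); first by lra.
by rewrite ler_wpM2l.
Qed.

(** Testing with sigma gives b sigma sigma = g sigma - f u. Inserting the bound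
    on u and writing N = |g| + |f|, coercivity yields
    |sigma|^2 <= D N |sigma| + D N^2. *)
Lemma saddle_point_bound :
  exists2 K : R, 0 < K &
    forall (g : dual S) (f : dual V) (sigma : S) (u : V),
      (forall tau, b sigma tau + d tau u = g tau) ->
      (forall v, d sigma v = f v) ->
      `|sigma| + `|u| <= K * (`|g| + `|f|).
Proof.
pose D := C * (1 + M * A) + C * (M + 1).
have MA : 0 < M * A by rewrite mulr_gt0.
have D0 : 0 < D by rewrite addr_gt0// mulr_gt0// addr_gt0.
exists (D + 1 + M * (1 + A * (D + 1))).
  by rewrite !addr_gt0// mulr_gt0// addr_gt0// mulr_gt0// addr_gt0.
move=> g f sigma u eq1 eq2.
have -> : f = d sigma by apply/val_inj/funext => v; exact/esym/eq2.
set F := `|d sigma|; set G := `|g|; set N := G + F; set x := `|sigma|.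
have F0 : 0 <= F := normr_ge0 _.
have G0 : 0 <= G := normr_ge0 _.
have x0 : 0 <= x := normr_ge0 _.
have N0 : 0 <= N by rewrite addr_ge0.
have GN : G <= N by rewrite lerDl.
have FN : F <= N by rewrite lerDr.
have uB : `|u| <= M * (N + A * x).
  by apply: le_trans (multiplier_bound eq1) _; rewrite ler_pM2l// lerD2r.
have sB : x <= (D + 1) * N.
  apply: le_of_sqr_le => //; first exact: ltW.
  have gs : g sigma <= G * x := le_trans (ler_norm _) (dual_norm_ub g sigma).
  have := dual_norm_ub (d sigma) u; rewrite ler_norml => /andP[fu _].
  have {fu} fu : - d sigma u <= N * (M * (N + A * x)).
    rewrite lerNl; apply: le_trans fu; rewrite lerN2.
    by apply: ler_pM.
  have bs : b sigma sigma + F ^+ 2 <=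
      N * x + N * (M * (N + A * x)) + N ^+ 2.
    have GNx : G * x <= N * x by rewrite ler_wpM2r.
    have FF : F ^+ 2 <= N ^+ 2 by rewrite ler_pXn2r.
    by have := eq1 sigma; lra.
  apply: le_trans (b_coercive sigma) _.
  apply: (@le_trans _ _ (C * (N * x + N * (M * (N + A * x)) + N ^+ 2))).
    by rewrite ler_pM2l.
  have Nx : 0 <= C * (1 + M * A) * N ^+ 2.
    apply: mulr_ge0; rewrite ?exprn_ge0//; apply: mulr_ge0; apply/ltW => //.
    by rewrite addr_gt0.
  have Nx' : 0 <= C * (M + 1) * (N * x).
    by apply: mulr_ge0; apply: mulr_ge0 => //; apply/ltW => //; rewrite addr_gt0.
  by rewrite /D; lra.
rewrite mulrDl; apply: lerD => //; apply: le_trans uB _.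
rewrite -mulrA ler_pM2l// mulrDl mul1r lerD2l -mulrA ler_pM2l//.
Qed.

(** With d tau = riesz z, the element tau - E z lies in the kernel of d, so a
    functional that vanishes there takes the same value at tau and at E z. The
    first equation thus only has to be checked on the range of E, where it
    defines u. *)
Lemma saddle_point_exists (g : dual S) (f : dual V) : continuous d ->
  exists su : S * V, (forall tau, b su.1 tau + d tau su.2 = g tau) /\
                     (forall v, d su.1 v = f v).
Proof.
move=> dc; have [w <-] := riesz_surj f.
have bl x : linear_for *%R (b x) by move=> t y z; rewrite linearP.
have bd x : b x \in @is_dual R S.
  by apply: (bounded_is_dual (bl x) (M := A * `|x|)) => y; exact: b_bound.
pose ker := d @^-1` [set 0].
have [|||//|x dx|s0 /= ds0 bs0] :=
  @coercive_form_representation R S b ker A C (g - Dual (bd (E w))) b_ge0 b_le.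
- apply: closed_comp => [x _|]; first exact: dc.
  apply: accessible_closed_set1; apply: hausdorff_accessible.
  exact: norm_hausdorff.
- by rewrite /ker/= linear0.
- by move=> t x y; rewrite /ker/= linearP => -> ->; rewrite scaler0 addr0.
- by have := b_coercive x; rewrite dx normr0 expr0n addr0.
set s := E w + s0.
have ds : d s = riesz w by rewrite linearD/= dE ds0 addr0.
have res tau : d tau = 0 -> b s tau = g tau.
  move=> dt; rewrite /s linearDl/= (bs0 _ dt).
  change (b (E w) tau + (g tau - b (E w) tau) = g tau).
  by rewrite addrCA subrr addr0.
have hd : (fun v => g (E v) - b s (E v)) \in @is_dual R V.
  apply: (@bounded_is_dual _ _ _ ((`|g - Dual (bd s)|) * M)).
    by move=> t x y; rewrite !linearP/= /GRing.scale/=; ring.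
  move=> v; rewrite -mulrA; apply: le_trans (dual_norm_ub (g - Dual (bd s)) _) _.
  by apply: ler_wpM2l; [exact: dual_norm_ge0|exact: E_le].
have [u uh] := riesz_surj (Dual hd).
exists (s, u); split=> [tau|v] /=; last by rewrite ds.
have [z zt] := riesz_surj (d tau).
have : b s (tau - E z) = g (tau - E z).
  by apply: res; rewrite linearB/= dE zt subrr.
rewrite 2!linearB/= -zt /= innerC.
have : inner u z = g (E z) - b s (E z) by rewrite -[LHS]/(riesz u z) uh.
by lra.
Qed.

End saddle_point.

Theorem theorem3p1 (R : realType) (X V Sigma : hilbertType R)
    (P tSigma : completeNormedModType R)
    (iota : {linear Sigma -> dual X}) (iota_inj : injective iota)
    (formX : {symmetric (dual X)})
    (formX_ge0 : forall x : dual X, 0 <= formX x x)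
    (dm : {linear P -> Sigma}) (d : {linear Sigma -> dual V})
    (PiV : {linear V -> tSigma}) (PiSigma : {linear tSigma -> Sigma})
    (dm_cont : continuous dm) (d_cont : continuous d)
    (PiV_cont : continuous PiV) (PiSigma_cont : continuous PiSigma)
    (exact_dm_d : exact_seq dm d)
    (d_Pi : forall v : V, d (PiSigma (PiV v)) = riesz v)
    (norm_eqv : eqsim (fun tau : Sigma => `|tau| ^+ 2)
      (fun tau : Sigma =>
         seminorm_of formX (iota tau) ^+ 2 + `|d tau| ^+ 2)) :
  (forall (g : dual Sigma) (f : dual V),
     exists! su : Sigma * V, mixed_problem iota formX d g f su.1 su.2) /\
  (exists2 C : R, 0 < C &
     forall (g : dual Sigma) (f : dual V) (sigma : Sigma) (u : V),
       mixed_problem iota formX d g f sigma u ->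
       `|sigma| + `|u| <= C * (`|g| + `|f|)).
Proof.
pose b : {symmetric Sigma} := pullback_form formX iota.
pose E : {linear V -> Sigma} := PiSigma \o PiV.
have [M M0 EM] : exists2 M, 0 < M & forall v, `|E v| <= M * `|v|.
  apply: continuous_linear_bound => v.
  by apply: continuous_comp; [exact: PiV_cont|exact: PiSigma_cont].
have [[C C0 bC] [A A0 bA]] := norm_eqv.
have semiE tau : seminorm_of formX (iota tau) ^+ 2 = b tau tau.
  by rewrite /seminorm_of sqr_sqrtr.
have b0 tau : 0 <= b tau tau by exact: formX_ge0.
have b_le tau : b tau tau <= A * `|tau| ^+ 2.
  by apply: le_trans (bA tau); rewrite semiE lerDl exprn_ge0.
have b_coer tau : `|tau| ^+ 2 <= C * (b tau tau + `|d tau| ^+ 2).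
  by rewrite -semiE; exact: bC.
have [K K0 stab] := saddle_point_bound b0 A0 b_le C0 b_coer M0 EM d_Pi.
split; last by exists K => // g f sigma u [? ?]; exact: stab.
move=> g f.
have [[s u] /= [eq1 eq2]] :=
  saddle_point_exists b0 b_le C0 b_coer EM d_Pi g f d_cont.
exists (s, u); split=> [//|[s' u'] /= [eq1' eq2']].
have : `|s - s'| + `|u - u'| <= K * (`|0 : dual Sigma| + `|0 : dual V|).
  apply: stab => [tau|v].
    rewrite linearBl linearB/=; have := eq1 tau; have := eq1' tau.
    change (b s' tau + d tau u' = g tau -> b s tau + d tau u = g tau ->
      b s tau - b s' tau + (d tau u - d tau u') = 0); lra.
  rewrite linearB/=; change (d s v - d s' v = 0).
  by rewrite eq2 eq2' subrr.
rewrite !normr0 addr0 mulr0 => le0.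
have ns : 0 <= `|s - s'| := normr_ge0 _.
have nu : 0 <= `|u - u'| := normr_ge0 _.
have /eqP : `|s - s'| = 0 by lra.
have /eqP : `|u - u'| = 0 by lra.
by rewrite !normr_eq0 !subr_eq0 => /eqP-> /eqP->.
Qed.
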